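(* Let $d\ge1$, $\sigma_1>0$, $\beta>3$, $p_+\in(0,1)$ with $p_-:=1-p_+\ge\frac12$, and let $P_{XY}$ be the distribution with $\mathbb P(Y=+1)=p_+$, $\mathbb P(Y=-1)=p_-$, $X\mid Y=+1\sim\mathcal N(0,\sigma_1^2\mathbf I_d)$, $X\mid Y=-1\sim\mathcal N(0,\beta\sigma_1^2\mathbf I_d)$. Let $k_1,k_2>0$ and define $\psi(x)=k_1\|x\|_2^2+k_2$. Let $(X_1,Y_1),\dots,(X_N,Y_N)$ be training data with labels $Y_i\in\{\pm1\}$ such that $N_+:=\#\{i:Y_i=+1\}\ge1$ and $N_-:=\#\{i:Y_i=-1\}\ge1$, where, given the labels, the $X_i$ are independent with $X_i\sim\mathcal N(0,\sigma_1^2\mathbf I_d)$ if $Y_i=+1$ and $X_i\sim\mathcal N(0,\beta\sigma_1^2\mathbf I_d)$ if $Y_i=-1$. Set $Z_i=\psi(X_i)$, $$b=\frac12\Big(\frac{\sum_{i=1}^N\mathbf 1_{\{Y_i=+1\}}Z_i}{N_+}+\frac{\sum_{i=1}^N\mathbf 1_{\{Y_i=-1\}}Z_i}{N_-}\Big),$$ and $f_{ss}(x)=\mathrm{sign}(-\psi(x)+b)$, with $\mathrm{err}_{f_{ss}}=\mathbb P_{(X,Y)\sim P_{XY}}(f_{ss}(X)\neq Y)$ for $(X,Y)$ independent of the training data. Then for any $\delta\in\big(0,\frac{\beta-1}{\beta+1}\big)$, with probability (over the training data) at least $1-2e^{-N_-d\delta^2/8}-2e^{-N_+d\delta^2/8}$,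 $$\mathrm{err}_{f_{ss}}\le\begin{cases}p_+e^{-d\frac{(\beta-1-(1+\beta)\delta)^2}{32}}+p_-e^{-d\frac{(\beta-1-(1+\beta)\delta)^2}{32\beta^2}}, & \text{if }\delta\in\big[\frac{\beta-3}{\beta+1},\frac{\beta-1}{\beta+1}\big),\\[4pt] p_+e^{-d\frac{\beta-1-(1+\beta)\delta}{16}}+p_-e^{-d\frac{(\beta-1-(1+\beta)\delta)^2}{32\beta^2}}, & \text{if }\delta\in\big(0,\frac{\beta-3}{\beta+1}\big).\end{cases}$$
   Context: $\mathbf I_d$ is the $d\times d$ identity matrix. The map $\psi$ models a representation learned by self-supervision, and $f_{ss}$ is a linear classifier on the feature $Z=\psi(X)$ with intercept $b$ equal to the midpoint of the class-wise feature means on the training data. Ties $\psi(X)=b$ occur with probability zero. *)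

(* Defs.v *)
From HB Require Import structures.
From mathcomp Require Import all_boot all_order all_algebra.
From mathcomp Require Import all_classical all_reals all_analysis.
Set Implicit Arguments. Unset Strict Implicit. Unset Printing Implicit Defensive.
Import Order.TTheory GRing.Theory Num.Theory.
Local Open Scope classical_set_scope.
Local Open Scope ring_scope.

Definition indep_family (R : realType) (d : measure_display) (T : measurableType d)
  (P : probability T R) (I : finType) (X : I -> {RV P >-> R}) : Prop :=
  forall B : I -> set R, (forall i, measurable (B i)) ->
    P (\bigcap_(i in [set: I]) (X i @^-1` B i)) =
    (\prod_(i : I) P (X i @^-1` B i))%E.

Definition psi (R : realType) (d : nat) (k1 k2 : R) (x : 'I_d -> R) : R :=
  k1 * (\sum_(j < d) x j ^+ 2) + k2.

Definition f_ss (R : realType) (d : nat) (k1 k2 b : R) (x : 'I_d -> R) : R :=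
  Num.sg (- psi k1 k2 x + b).

Definition Ncount (R : realType) (N : nat) (Y : 'I_N -> R) (s : R) : nat :=
  #|[set i : 'I_N | Y i == s]|.

Definition intercept (R : realType) (N d : nat) (k1 k2 : R) (Y : 'I_N -> R)
  (x : 'I_N -> 'I_d -> R) : R :=
  2^-1 * ((\sum_(i < N | Y i == 1) psi k1 k2 (x i)) / (Ncount Y 1)%:R
        + (\sum_(i < N | Y i == -1) psi k1 k2 (x i)) / (Ncount Y (-1))%:R).

Definition err_bound (R : realType) (d : nat) (beta pplus delta : R) : R :=
  let pminus := 1 - pplus in
  let e := beta - 1 - (1 + beta) * delta in
  if (beta - 3) / (beta + 1) <= delta then
    pplus * expR (- (d%:R * e ^+ 2 / 32))
    + pminus * expR (- (d%:R * e ^+ 2 / (32 * beta ^+ 2)))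
  else
    pplus * expR (- (d%:R * e / 16))
    + pminus * expR (- (d%:R * e ^+ 2 / (32 * beta ^+ 2))).

(* Main.v *)
(** A squared standard Gaussian has moment generating function
    [(1 - 2 lam)^(-1/2) <= exp (lam + 2 lam^2)] for [|lam| <= 1/4], so by the
    Chernoff method a sum of [n] of them deviates from [n] by a relative amount
    [t] with probability at most [exp (- n t^2 / 8)], or [exp (- n t / 8)] above
    the mean when [t > 1].  Applied to the [N+ d] and [N- d] training
    coordinates, this confines the intercept, up to probability
    [2 exp (- N- d delta^2 / 8) + 2 exp (- N+ d delta^2 / 8)], to the window
    [k1 sigma1^2 d (1 + beta) (1 -+ delta) / 2 + k2].  Inside that window an error
    on class [+1] forces a relative deviation [e / 2] of [|X|^2] above its mean
    and an error on class [-1] one of [e / (2 beta)] below it, where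
    [e = beta - 1 - (1 + beta) delta]; the same tail bounds conclude. *)

Require Import Defs.
From HB Require Import structures.
From mathcomp Require Import all_boot all_order all_algebra.
From mathcomp Require Import all_classical all_reals all_analysis.
From mathcomp Require Import measurable_realfun ring lra.
Import Order.TTheory GRing.Theory Num.Theory.
Local Open Scope classical_set_scope.
Local Open Scope ring_scope.
Set Implicit Arguments. Unset Strict Implicit. Unset Printing Implicit Defensive.

Import HBNNSimple.

(** * Integrals of nonnegative functions from measures of sets *)

(** Both sides are linear in [f] and commute with increasing limits, so the identity passes from
    indicators to simple functions and then, by monotone convergence, to every nonnegative
    measurable [f]. The weight [g] serves below once as a Gaussian density and once as a product of
    frozen factors. *)
Lemma ge0_integral_transfer (R : realType) (d1 d2 : measure_display)
  (T : measurableType d1) (U : measurableType d2)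
  (P : {measure set T -> \bar R}) (mu : {measure set U -> \bar R})
  (X : T -> U) (g : T -> R) (C : R) (f : U -> R) :
  measurable_fun setT X -> measurable_fun setT g -> (forall t, 0 <= g t) ->
  0 <= C ->
  (forall B, measurable B ->
     \int[P]_t (g t * \1_B (X t))%:E = C%:E * mu B)%E ->
  measurable_fun setT f -> (forall x, 0 <= f x) ->
  (\int[P]_t (g t * f (X t))%:E = C%:E * \int[mu]_x (f x)%:E)%E.
Proof.
move=> mX mg g0 C0 H mf f0.
have mfE : measurable_fun [set: U] (EFin \o f) by exact/measurable_EFinP.
pose h := nnsfun_approx measurableT mfE.
have hfE x : (h n x)%:E @[n --> \oo] --> (f x)%:E.
  apply: (@cvg_nnsfun_approx _ _ _ _ measurableT _ mfE) => //.
  by move=> y _; rewrite lee_fin.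
have nd_h x : nondecreasing_seq (h ^~ x).
  by move=> a b ab; exact/lefP/nd_nnsfun_approx.
have mh n : measurable_fun setT (h n) by exact: measurable_funPT.
have simple n : (\int[P]_t (g t * h n (X t))%:E =
                 C%:E * \int[mu]_x (h n x)%:E)%E.
  have mhi y : measurable (h n @^-1` [set y]) by exact: measurable_funPTI.
  have mgi y : measurable_fun setT (fun t => g t * \1_(h n @^-1` [set y]) (X t)).
    have mi : measurable_fun setT (\1_(h n @^-1` [set y]) : U -> R).
      exact: measurable_indic.
    by apply: measurable_funM => //; exact: (measurableT_comp mi mX).
  transitivity (\int[P]_t \sum_(y \in range (h n))
      (g t * (y * \1_(h n @^-1` [set y]) (X t)))%:E)%E.
    apply: eq_integral => t _; rewrite (fimfunE (h n) (X t)).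
    rewrite EFinM -fsumEFin// ge0_mule_fsumr.
      by apply: eq_fsbigr => y _; rewrite EFinM.
    by move=> y; rewrite EFinM nnfun_muleindic_ge0.
  rewrite ge0_integral_fsum//; last 2 first.
  - by move=> y; apply/measurable_EFinP; under eq_fun do rewrite mulrCA; exact: measurable_funM.
  - move=> y t _; rewrite EFinM; apply: mule_ge0; first by rewrite lee_fin.
    by rewrite EFinM nnfun_muleindic_ge0.
  rewrite integralT_nnsfun sintegralE ge0_mule_fsumr; last first.
    by move=> y; exact: nnsfun_mulemu_ge0.
  apply: eq_fsbigr => y; rewrite inE => -[u _ <-].
  under eq_integral do rewrite mulrCA EFinM.
  rewrite ge0_integralZl_EFin//; last 2 first.
  - by move=> t _; rewrite lee_fin mulr_ge0.
  - exact/measurable_EFinP.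
  by rewrite H// muleCA.
have cP : (\int[P]_t (g t * h n (X t))%:E @[n --> \oo] -->
           \int[P]_t (g t * f (X t))%:E)%E.
  under [X in _ --> X]eq_integral => t _.
    have -> : (g t * f (X t))%:E = limn (fun n => (g t * h n (X t))%:E).
      apply/esym/cvg_lim => //; under eq_fun do rewrite EFinM.
      by rewrite EFinM; apply: cvgeZl.
    over.
  apply: (@cvg_monotone_convergence _ _ _ P setT measurableT
    (fun n t => (g t * h n (X t))%:E)) => //.
  - move=> n; apply/measurable_EFinP/measurable_funM => //.
    exact: measurableT_comp.
  - by move=> n t _; rewrite lee_fin mulr_ge0.
  - by move=> t _ a b ab; rewrite lee_fin ler_wpM2l// nd_h.
have cmu : (C%:E * \int[mu]_x (h n x)%:E @[n --> \oo] -->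
            C%:E * \int[mu]_x (f x)%:E)%E.
  apply: cvgeZl => //.
  under [X in _ --> X]eq_integral => x _.
    rewrite (_ : (f x)%:E = limn (fun n => (h n x)%:E)); last first.
      by apply/esym/cvg_lim.
    over.
  apply: (@cvg_monotone_convergence _ _ _ mu setT measurableT
    (fun n x => (h n x)%:E)) => //.
  - by move=> n; apply/measurable_EFinP.
  - by move=> n t _; rewrite lee_fin.
  - by move=> t _ a b ab; rewrite lee_fin nd_h.
have eqs : (fun n => \int[P]_t (g t * h n (X t))%:E)%E =
           (fun n => C%:E * \int[mu]_x (h n x)%:E)%E by exact/funext.
by rewrite eqs in cP; apply: cvg_unique cP cmu.
Qed.

(** * Moment generating function of a squared Gaussian *)

Lemma expR_ge2 (R : realType) (x : R) : 0 <= x -> 1 + x + x ^+ 2 / 2 <= expR x.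
Proof.
move=> x0; have := @nondecreasing_cvgn_le R (series (exp_coeff x)) _ _ 3.
rewrite /series/= !big_nat_recr//= big_nil /exp_coeff/= => H.
apply: le_trans (H _ _).
- by rewrite !factS fact0 /= ; lra.
- by apply: nondecreasing_series => n _ _; exact: exp_coeff_ge0.
- exact: is_cvg_series_exp_coeff.
Qed.

(** This is [- ln (1 - u) <= u + u ^+ 2]. Since [(1 - u) * (1 + u + u ^+ 2) = 1 - u ^+ 3], the
    first-order bound on [expR] suffices for [u < 0], while [0 < u] calls for the quadratic term. *)
Lemma one_sub_expR_ge (R : realType) (u : R) : `|u| <= 2^-1 ->
  1 <= (1 - u) * expR (u + u ^+ 2).
Proof.
rewrite ler_norml => /andP[u1 u2]; have [u0|u0] := leP 0 u.
  have v0 : 0 <= u + u ^+ 2 by nra.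
  apply: (le_trans _ (ler_wpM2l _ (expR_ge2 v0))); last by lra.
  have h : u <= (1 - u) * (1 + u) ^+ 2 / 2 by nra.
  have -> : (1 - u) * (1 + (u + u ^+ 2) + (u + u ^+ 2) ^+ 2 / 2) =
    1 + u ^+ 2 * ((1 - u) * (1 + u) ^+ 2 / 2 - u) by field.
  by rewrite lerDl mulr_ge0 ?sqr_ge0 ?subr_ge0.
have h := expR_ge1Dx (u + u ^+ 2).
apply: (le_trans _ (ler_wpM2l _ h)); last by lra.
nra.
Qed.

Lemma normal_peak_scale (R : realType) (s k : R) : 0 < k ->
  k * normal_peak (s * k) = normal_peak s.
Proof.
move=> k0; rewrite /normal_peak; move: (@pi R) => p.
have -> : (s * k) ^+ 2 * p *+ 2 = k ^+ 2 * (s ^+ 2 * p *+ 2).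
  by rewrite mulrnAr exprMn -mulrA mulrCA.
rewrite sqrtrM ?sqr_ge0// sqrtr_sqr gtr0_norm// invfM mulrA divff ?mul1r//.
by rewrite gt_eqF.
Qed.

Lemma gauss_exponentE (F : numFieldType) (x s k lam : F) :
  s != 0 -> 1 - 2 * lam != 0 -> k ^+ 2 = (1 - 2 * lam)^-1 ->
  - x ^+ 2 / (s ^+ 2 *+ 2) + lam * (x / s) ^+ 2 =
  - x ^+ 2 / ((s * k) ^+ 2 *+ 2).
Proof.
move=> s0 l0 k2.
have -> : (s * k) ^+ 2 = s ^+ 2 / (1 - 2 * lam).
  by rewrite exprMn k2.
by field; rewrite s0 l0.
Qed.

(** Multiplying the density of standard deviation [s] by the integrand gives [k] times the density
    of standard deviation [s * k], where [k = (1 - 2 lam)^(-1/2)]; the latter density has mass 1,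
    which leaves [k]. *)
Lemma normal_sqr_mgf (R : realType) (s lam : R) : 0 < s -> lam < 2^-1 ->
  (\int[normal_prob 0 s]_x (expR (lam * (x / s) ^+ 2))%:E =
   ((Num.sqrt (1 - 2 * lam))^-1)%:E)%E.
Proof.
move=> s0 l1; set k := (Num.sqrt _)^-1.
have r0 : 0 < 1 - 2 * lam by lra.
have k0 : 0 < k by rewrite invr_gt0 sqrtr_gt0.
have k2 : k ^+ 2 = (1 - 2 * lam)^-1 by rewrite /k exprVn sqr_sqrtr ?ltW.
have me : measurable_fun [set: R] (fun x => expR (lam * (x / s) ^+ 2)).
  apply: measurableT_comp => //; apply: measurable_funM => //.
  by apply: measurable_funX; apply: measurable_funM.
(* [normal_prob] is the integral of its density over sets; the transfer turns an integral against it
   into a Lebesgue integral weighted by [normal_pdf]. *)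
have h := @ge0_integral_transfer R _ _ _ _ (@lebesgue_measure R)
  (normal_prob 0 s) idfun (normal_pdf 0 s) 1
  (fun x => expR (lam * (x / s) ^+ 2)).
rewrite -[LHS]mul1e -h//; last 4 first.
- exact: measurable_id.
- exact: measurable_normal_pdf.
- by move=> t; exact: normal_pdf_ge0.
- move=> B mB; rewrite mul1e /normal_prob [RHS]integral_mkcond.
  by apply: eq_integral => x _; rewrite epatch_indic/= EFinM.
have sk0 : s * k != 0 by rewrite mulf_neq0 ?gt_eqF.
transitivity (\int[lebesgue_measure]_x (k%:E * (normal_pdf 0 (s * k) x)%:E))%E.
  apply: eq_integral => x _; rewrite -EFinM; congr EFin.
  rewrite !normal_pdfE ?gt_eqF ?mulr_gt0// /normal_fun/= !subr0.
  have -> : k * (normal_peak (s * k) * expR (- x ^+ 2 / ((s * k) ^+ 2 *+ 2)))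
     = (k * normal_peak (s * k)) * expR (- x ^+ 2 / ((s * k) ^+ 2 *+ 2)).
    by rewrite mulrA.
  rewrite normal_peak_scale//.
  rewrite -mulrA -expRD; congr (_ * expR _).
  exact: (gauss_exponentE x (lt0r_neq0 s0) (lt0r_neq0 r0) k2).
rewrite ge0_integralZl_EFin//.
- by rewrite integral_normal_pdf mule1.
- by move=> x _; rewrite lee_fin normal_pdf_ge0.
- by apply/measurable_EFinP; exact: measurable_normal_pdf.
- exact: ltW.
Qed.

(** After squaring, this is [one_sub_expR_ge] at [u = 2 * lam], whose range [|u| <= 1/2] is the
    condition on [lam]. *)
Lemma normal_sqr_mgf_le (R : realType) (lam : R) : `|lam| <= 4^-1 ->
  (Num.sqrt (1 - 2 * lam))^-1 <= expR (lam + 2 * lam ^+ 2).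
Proof.
move=> hl; have /andP[l1 l2] : - 4^-1 <= lam <= 4^-1 by rewrite -ler_norml.
have r0 : 0 < 1 - 2 * lam by lra.
rewrite -(@ler_pXn2r _ 2)// ?nnegrE ?invr_ge0 ?sqrtr_ge0 ?expR_ge0//.
rewrite exprVn sqr_sqrtr ?(ltW r0)// -div1r ler_pdivrMr// -expRM_natl.
have := @one_sub_expR_ge R (2 * lam); rewrite ler_norml => /(_ _)/le_trans; apply.
  by apply/andP; split; lra.
rewrite mulrC le_eqVlt; apply/orP; left; apply/eqP; congr (expR _ * _).
by ring.
Qed.

(** * Factorisation of expectations under product laws *)

(** Lifts the product rule from boxes to products of nonnegative functions, as the exponential
    moment of a sum requires. *)
Lemma integral_prod_rv (R : realType) (dT : measure_display)
  (T : measurableType dT) (Q : {measure set T -> \bar R}) (I : finType)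
  (X : I -> T -> R) (A : set T) (mu : I -> probability (measurableTypeR R) R) (c : R)
  (f : I -> R -> R) (m : I -> R) :
  (forall i, measurable_fun setT (X i)) -> measurable A -> 0 <= c ->
  (forall B : I -> set R, (forall i, measurable (B i)) ->
    Q (A `&` \bigcap_(i in [set: I]) (X i @^-1` B i)) =
    (c%:E * \prod_(i : I) mu i (B i))%E) ->
  (forall i, measurable_fun setT (f i)) -> (forall i x, 0 <= f i x) ->
  (forall i, \int[mu i]_x (f i x)%:E = (m i)%:E)%E ->
  (\int[Q]_t (\1_A t * \prod_(i : I) f i (X i t))%:E =
   (c * \prod_(i : I) m i)%:E)%E.
Proof.
move=> mX mA c0 H mf f0 fm.
have m0 i : 0 <= m i by rewrite -lee_fin -fm; apply: integral_ge0 => x _; rewrite lee_fin.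
(* Indicators are replaced by the functions [f i] one index at a time: with the
   other factors fixed, both sides are measures in [B i]. *)
pose h (s : seq I) (B : I -> set R) i : R -> R := if i \in s then f i else \1_(B i).
pose n (s : seq I) (B : I -> set R) i : R := if i \in s then m i else fine (mu i (B i)).
suff main : forall (s : seq I), uniq s -> forall B, (forall i, measurable (B i)) ->
    (\int[Q]_t (\1_A t * \prod_(i : I) h s B i (X i t))%:E =
     (c * \prod_(i : I) n s B i)%:E)%E.
  have := main (enum I) (enum_uniq _) (fun=> setT) (fun=> measurableT).
  have hE i : h (enum I) (fun=> setT) i = f i by rewrite /h mem_enum.
  have nE i : n (enum I) (fun=> setT) i = m i by rewrite /n mem_enum.
  under eq_bigr do rewrite nE; move=> <-.
  by apply: eq_integral => t _; under [in RHS]eq_bigr do rewrite hE.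
have muf i B : measurable B -> ((fine (mu i B))%:E = mu i B)%E.
  by move=> mB; rewrite fineK// fin_num_measure.
elim => [_ B mB|i s IH /= /andP[si us] B mB].
  rewrite /h /n /=.
  transitivity (\int[Q]_t (\1_(A `&` \bigcap_(i in [set: I]) (X i @^-1` B i)) t)%:E)%E.
    apply: eq_integral => t _; congr EFin; rewrite indicI; congr (_ * _).
    have [Bt|nBt] := pselect ((\bigcap_(i in [set: I]) (X i @^-1` B i)) t).
      rewrite [RHS]indicE mem_set// big1// => i _.
      by rewrite indicE mem_set//; exact: Bt.
    rewrite [RHS]indicE memNset//.
    have [i nBi] : exists i, ~ B i (X i t).
      by apply/existsNP => Ball; apply: nBt => i _; exact: Ball.
    by rewrite (bigD1 i)//= indicE memNset ?mul0r.
  have mcap : measurable (\bigcap_(i in [set: I]) (X i @^-1` B i)).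
    apply: fin_bigcap_measurable; first exact: finite_finset.
    by move=> i _; rewrite -[_ @^-1` _]setTI; exact: mX.
  rewrite integral_indic//; last exact: measurableI.
  rewrite setIT H// EFinM -prodEFin; congr (_ * _)%E.
  by apply: eq_bigr => i _; rewrite muf//; exact: mB.
have mh (s' : seq I) B' j : (forall i, measurable (B' i)) -> measurable_fun setT (h s' B' j).
  by move=> mB'; rewrite /h; case: ifP => // _; exact: measurable_indic.
have h0 s' B' j x : 0 <= h s' B' j x.
  by rewrite /h; case: ifP.
have n0 s' B' j : 0 <= n s' B' j by rewrite /n; case: ifP => // _; exact: fine_ge0.
(* [g] and [C] freeze the factors at indices other than [i], so that only the factor in [X i]
   remains to be transferred. *)
pose g t := \1_A t * \prod_(j | j != i) h (i :: s) B j (X j t).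
pose C := c * \prod_(j | j != i) n (i :: s) B j.
have hi : h (i :: s) B i = f i by rewrite /h mem_head.
have ni : n (i :: s) B i = m i by rewrite /n mem_head.
transitivity (\int[Q]_t (g t * f i (X i t))%:E)%E.
  by apply: eq_integral => t _; rewrite (bigD1 i)//= hi /g -mulrA [X in _ * X]mulrC.
have mg : measurable_fun setT g.
  apply: measurable_funM; first exact: measurable_indic.
  under eq_fun do rewrite big_mkcond.
  apply: measurable_prod => j _; case: (j != i) => //.
  exact: measurableT_comp (mh _ _ _ mB) (mX j).
have g0 t : 0 <= g t by rewrite mulr_ge0// prodr_ge0.
have C0 : 0 <= C by rewrite mulr_ge0// prodr_ge0.
have HC B0 : measurable B0 -> (\int[Q]_t (g t * \1_B0 (X i t))%:E = C%:E * mu i B0)%E.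
  (* As [i] is not in [s], overriding [B] at [i] by [B0] makes [\1_B0] the factor at [i], and the
     induction hypothesis applies. *)
  move=> mB0; pose B' j := if j == i then B0 else B j.
  have mB' j : measurable (B' j) by rewrite /B'; case: ifP.
  have hBi : h s B' i = \1_B0 by rewrite /h (negbTE si) /B' eqxx.
  have nBi : n s B' i = fine (mu i B0) by rewrite /n (negbTE si) /B' eqxx.
  transitivity (\int[Q]_t (\1_A t * \prod_(i0 : I) h s B' i0 (X i0 t))%:E)%E.
    apply: eq_integral => t _; congr EFin; rewrite [in RHS](bigD1 i)//=.
    rewrite hBi /g -mulrA; congr (_ * _).
    rewrite mulrC; congr (_ * _); apply: eq_bigr => j ji.
    by rewrite /h inE (negbTE ji)/= /B' (negbTE ji).
  rewrite IH// (bigD1 i)//= nBi EFinM EFinM muf// muleCA muleC /C EFinM; congr (_ * _ * _)%E.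
  congr EFin; apply: eq_bigr => j ji.
  by rewrite /n inE (negbTE ji)/= /B' (negbTE ji).
rewrite (@ge0_integral_transfer R _ _ T (measurableTypeR R) Q (mu i) (X i) g C
  (f i) (mX i) mg g0 C0 HC (mf i) (f0 i)).
by rewrite fm -EFinM (bigD1 i)//= ni /C mulrCA mulrC mulrA [X in X * _]mulrC.
Qed.

(* With [A] an event of probability [c], this is independence and the marginal
   laws of the [X i] conditionally on [A]; [A := setT], [c := 1] is the
   unconditional case. *)
Definition product_law (R : realType) (dT : measure_display)
  (T : measurableType dT) (Q : {measure set T -> \bar R}) (A : set T) (c : R)
  (I : finType) (X : I -> T -> R) (mu : I -> probability (measurableTypeR R) R) : Prop :=
  forall B : I -> set R, (forall i, measurable (B i)) ->
    Q (A `&` \bigcap_(i in [set: I]) (X i @^-1` B i)) =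
    (c%:E * \prod_(i : I) mu i (B i))%E.

(** * Tail bounds for sums of squared Gaussians *)

Lemma measurable_sum_sqr (R : realType) (dT : measure_display)
  (T : measurableType dT) (I : finType) (X : I -> T -> R) (S : pred I) :
  (forall i, measurable_fun setT (X i)) ->
  measurable_fun setT (fun t => \sum_(i | S i) X i t ^+ 2).
Proof.
move=> mX; under eq_fun do rewrite big_mkcond.
by apply: measurable_sum => i; case: (S i) => //; exact: measurable_funX.
Qed.

Lemma measurable_le_set (R : realType) (dT : measure_display)
  (T : measurableType dT) (f g : T -> R) :
  measurable_fun setT f -> measurable_fun setT g ->
  measurable [set t | f t <= g t].
Proof.
move=> mf mg; have mtrue : measurable [set true] by [].
by have := measurable_fun_ler mf mg measurableT mtrue; rewrite setTI.
Qed.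

(** Markov's inequality on [A] for the exponential of [lam / s ^+ 2] times the sum. The sign of
    [lam] is free, so both tails follow from this one estimate. *)
Lemma sum_sqr_chernoff (R : realType) (dT : measure_display)
  (T : measurableType dT) (Q : {measure set T -> \bar R}) (A : set T) (c : R)
  (I : finType) (X : I -> T -> R) (mu : I -> probability (measurableTypeR R) R)
  (S : pred I) (n : nat) (s lam r : R) :
  (forall i, measurable_fun setT (X i)) -> measurable A -> 0 <= c ->
  product_law Q A c X mu -> (forall i, S i -> mu i = normal_prob 0 s) ->
  #|S| = n -> 0 < s -> `|lam| <= 4^-1 ->
  (Q (A `&` [set t | (r * s ^+ 2 <= lam * \sum_(i | S i) X i t ^+ 2)%R]) <=
   (c * expR (n%:R * (lam + 2 * lam ^+ 2) - r))%:E)%E.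
Proof.
move=> mX mA c0 HQ Smu Sn s0 hl.
(* Indices outside [S] carry the constant 1, of mean 1, so only the [n] Gaussian factors
   contribute. *)
pose f i (x : R) := if S i then expR (lam * (x / s) ^+ 2) else 1.
pose m i := if S i then (Num.sqrt (1 - 2 * lam))^-1 else 1.
have mf i : measurable_fun setT (f i).
  rewrite /f; case: (S i) => //; apply: measurableT_comp => //.
  by apply: measurable_funM => //; apply: measurable_funX; apply: measurable_funM.
have f0 i x : 0 <= f i x by rewrite /f; case: ifP => // _; exact: expR_ge0.
have fm i : (\int[mu i]_x (f i x)%:E = (m i)%:E)%E.
  rewrite /f /m; have [Si|/negbTE Si] := boolP (S i); last first.
    by rewrite integral_cst// mul1e; exact: probability_setT.
  rewrite Smu// normal_sqr_mgf//.
  by move: hl; rewrite ler_norml => /andP[]; lra.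
have := integral_prod_rv mX mA c0 HQ mf f0 fm.
set E := [set t | _]; move=> HI.
have mE : measurable E.
  by apply: measurable_le_set => //; apply: measurable_funM => //; exact: measurable_sum_sqr.
have fE t : \prod_i f i (X i t) = expR (lam / s ^+ 2 * \sum_(i | S i) X i t ^+ 2).
  rewrite mulr_sumr expR_sum [RHS]big_mkcond; apply: eq_bigr => i _.
  by rewrite /f; case: ifP => // _; rewrite expr_div_n mulrA [in RHS]mulrAC.
(* On the intersection of [A] and [E] the product of the [f i] is at least [expR r]. *)
have le1 : ((expR r)%:E * Q (A `&` E) <= (c * \prod_i m i)%:E)%E.
  rewrite -HI -[X in (X <= _)%E]integral_cst; last exact: measurableI.
  rewrite [leLHS]integral_mkcond; apply: ge0_le_integral => //.
  - by move=> t _; rewrite patchE; case: ifP => // _; rewrite lee_fin expR_ge0.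
  - by apply/(measurable_restrictT _ _).1 => //; exact: measurableI.
  - apply/measurable_EFinP/measurable_funM; first exact: measurable_indic.
    by apply: measurable_prod => i _; exact: measurableT_comp (mf i) (mX i).
  - move=> t _; rewrite patchE; case: ifPn => [|_]; last first.
      by rewrite lee_fin mulr_ge0// prodr_ge0.
    rewrite inE => -[At Et]; rewrite lee_fin indicE mem_set// mul1r fE ler_expR.
    by rewrite mulrAC ler_pdivlMr ?exprn_gt0.
have le2 : \prod_i m i <= expR (n%:R * (lam + 2 * lam ^+ 2)).
  rewrite -Sn expRM_natl -prodr_const [leRHS]big_mkcond; apply: ler_prod => i _.
  rewrite /m unfold_in; case: ifP => _; last by rewrite ler01 lexx.
  by rewrite invr_ge0 sqrtr_ge0/=; exact: normal_sqr_mgf_le.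
rewrite expRD expRN mulrA mulrC EFinM lee_pdivlMl ?expR_gt0//.
by rewrite (le_trans le1)// lee_fin ler_wpM2l.
Qed.

(** The exponent turns from quadratic to linear at [t = 1]; this is the origin of the two cases of
    [err_bound]. *)
Lemma sum_sqr_upper_tail (R : realType) (dT : measure_display)
  (T : measurableType dT) (Q : {measure set T -> \bar R}) (A : set T) (c : R)
  (I : finType) (X : I -> T -> R) (mu : I -> probability (measurableTypeR R) R)
  (S : pred I) (n : nat) (s t : R) :
  (forall i, measurable_fun setT (X i)) -> measurable A -> 0 <= c ->
  product_law Q A c X mu -> (forall i, S i -> mu i = normal_prob 0 s) ->
  #|S| = n -> 0 < s -> 0 <= t ->
  (Q (A `&` [set w | (s ^+ 2 * n%:R * (1 + t) <= \sum_(i | S i) X i w ^+ 2)%R]) <=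
   (c * expR (- (n%:R * (if t <= 1 then t ^+ 2 else t) / 8)))%:E)%E.
Proof.
move=> mX mA c0 HQ Smu Sn s0 t0.
(* [2 lam^2 - lam t] is minimal at [lam = t / 4]; the mgf bound caps [lam] at [1/4]. *)
pose lam := (if t <= 1 then t else 1) / 4.
have [l0 l1] : 0 <= lam /\ lam <= 4^-1 by rewrite /lam; case: (leP t 1); lra.
have hl : `|lam| <= 4^-1 by rewrite ger0_norm.
have := sum_sqr_chernoff (lam * (n%:R * (1 + t))) mX mA c0 HQ Smu Sn s0 hl.
set E1 := (X in (Q (A `&` X) <= _)%E -> _) => H.
have mE1 : measurable E1.
  by apply: measurable_le_set => //; apply: measurable_funM => //; exact: measurable_sum_sqr.
have mE : measurable [set w | s ^+ 2 * n%:R * (1 + t) <= \sum_(i | S i) X i w ^+ 2].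
  by apply: measurable_le_set => //; exact: measurable_sum_sqr.
apply: (@le_trans _ _ (Q (A `&` E1))).
  apply: le_measure; rewrite ?inE; [exact: measurableI|exact: measurableI|].
  move=> w [Aw /= Ew]; split => //; rewrite /E1/=.
  by rewrite -mulrA ler_wpM2l// mulrC mulrA.
apply: (le_trans H); rewrite lee_fin ler_wpM2l// ler_expR.
have n0 : 0 <= n%:R :> R by [].
rewrite -subr_ge0 /lam; case: (leP t 1) => t1.
  suff -> : - (n%:R * t ^+ 2 / 8) - (n%:R * (t / 4 + 2 * (t / 4) ^+ 2)
    - t / 4 * (n%:R * (1 + t))) = 0 by [].
  by field.
(* For [t <= 1] the exponents agree exactly; for [t > 1] the slack is [n (t - 1) / 8]. *)
have -> : - (n%:R * t / 8) - (n%:R * (1 / 4 + 2 * (1 / 4) ^+ 2)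
    - 1 / 4 * (n%:R * (1 + t))) = n%:R * ((t - 1) / 8) by field.
by apply: mulr_ge0 => //; lra.
Qed.

(** Here [lam = - t / 4]. A relative deviation below the mean is at most 1, so the cap on [lam]
    never binds and there is a single regime. *)
Lemma sum_sqr_lower_tail (R : realType) (dT : measure_display)
  (T : measurableType dT) (Q : {measure set T -> \bar R}) (A : set T) (c : R)
  (I : finType) (X : I -> T -> R) (mu : I -> probability (measurableTypeR R) R)
  (S : pred I) (n : nat) (s t : R) :
  (forall i, measurable_fun setT (X i)) -> measurable A -> 0 <= c ->
  product_law Q A c X mu -> (forall i, S i -> mu i = normal_prob 0 s) ->
  #|S| = n -> 0 < s -> 0 <= t <= 1 ->
  (Q (A `&` [set w | (\sum_(i | S i) X i w ^+ 2 <= s ^+ 2 * n%:R * (1 - t))%R]) <=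
   (c * expR (- (n%:R * t ^+ 2 / 8)))%:E)%E.
Proof.
move=> mX mA c0 HQ Smu Sn s0 /andP[t0 t1].
have hl : `|- (t / 4)| <= 4^-1 by rewrite normrN ger0_norm; lra.
have := sum_sqr_chernoff (- (t / 4) * (n%:R * (1 - t))) mX mA c0 HQ Smu Sn s0 hl.
set E1 := (X in (Q (A `&` X) <= _)%E -> _) => H.
have mE1 : measurable E1.
  by apply: measurable_le_set => //; apply: measurable_funM => //; exact: measurable_sum_sqr.
have mE : measurable [set w | \sum_(i | S i) X i w ^+ 2 <= s ^+ 2 * n%:R * (1 - t)].
  by apply: measurable_le_set => //; exact: measurable_sum_sqr.
apply: (@le_trans _ _ (Q (A `&` E1))).
  apply: le_measure; rewrite ?inE; [exact: measurableI|exact: measurableI|].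
  move=> w [Aw /= Ew]; split => //; rewrite /E1/=.
  by rewrite -mulrA !mulNr lerN2 ler_wpM2l// ?divr_ge0// [leRHS]mulrC mulrA.
apply: (le_trans H); rewrite lee_fin ler_wpM2l// ler_expR -subr_ge0.
have -> : - (n%:R * t ^+ 2 / 8) - (n%:R * (- (t / 4) + 2 * (- (t / 4)) ^+ 2)
    - - (t / 4) * (n%:R * (1 - t))) = 0 by field.
by [].
Qed.

(** * Measurability and algebra of the classifier and the intercept *)

Lemma measurable_psi (R : realType) (d : nat) (k1 k2 : R)
  (dQ : measure_display) (TQ : measurableType dQ) (Q : probability TQ R)
  (X : 'I_d -> {RV Q >-> R}) :
  measurable_fun setT (fun t => psi k1 k2 (fun j => X j t)).
Proof.
apply: measurable_funD => //; apply: measurable_funM => //.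
by apply: measurable_sum_sqr => j; exact: measurable_funPT.
Qed.

Lemma measurable_intercept (R : realType) (d N : nat) (k1 k2 : R)
  (dP : measure_display) (TP : measurableType dP) (P : probability TP R)
  (Y : 'I_N -> R) (X : 'I_N -> 'I_d -> {RV P >-> R}) :
  measurable_fun setT (fun w => intercept k1 k2 Y (fun i j => X i j w)).
Proof.
have mpsi i : measurable_fun setT (fun w => psi k1 k2 (fun j => X i j w)).
  exact: measurable_psi.
have msum (S : pred 'I_N) :
    measurable_fun setT (fun w => \sum_(i | S i) psi k1 k2 (fun j => X i j w)).
  under eq_fun do rewrite big_mkcond.
  by apply: measurable_sum => i; case: (S i).
by apply: measurable_funM => //; apply: measurable_funD; apply: measurable_funM.
Qed.

(** The inequality is weak because [Num.sg 0 = 0]: a tie counts as an error, for either label. *)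
Lemma f_ss_neq1 (R : realType) (d : nat) (k1 k2 b : R) (x : 'I_d -> R) :
  (f_ss k1 k2 b x != 1) = (b <= psi k1 k2 x).
Proof.
have N11 : (-1 == 1 :> R) = false by apply/eqP; lra.
rewrite /f_ss addrC; case: (ltrgtP b (psi k1 k2 x)) => h.
- by rewrite ltr0_sg ?subr_lt0// N11.
- by rewrite gtr0_sg ?subr_gt0// eqxx.
- by rewrite h subrr sgr0 eq_sym oner_eq0.
Qed.

Lemma f_ss_neqN1 (R : realType) (d : nat) (k1 k2 b : R) (x : 'I_d -> R) :
  (f_ss k1 k2 b x != -1) = (psi k1 k2 x <= b).
Proof.
have N11 : (1 == -1 :> R) = false by apply/eqP; lra.
rewrite /f_ss addrC; case: (ltrgtP b (psi k1 k2 x)) => h.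
- by rewrite ltr0_sg ?subr_lt0// eqxx.
- by rewrite gtr0_sg ?subr_gt0// N11.
- by rewrite h subrr sgr0 eq_sym oppr_eq0 oner_eq0.
Qed.

Lemma NcountE (R : realType) (N : nat) (Y : 'I_N -> R) (s : R) :
  Ncount Y s = #|[pred i | Y i == s]|.
Proof.
apply: eq_card => i; rewrite [in RHS]inE; apply/idP/idP => [/set_mem//|Yi].
by apply: mem_set.
Qed.

(** The double sum is flattened to pairs because the tail bounds are applied to the family of
    coordinates indexed by ['I_N * 'I_d]. *)
Lemma class_mean_psi (R : realType) (N d : nat) (k1 k2 s : R) (Y : 'I_N -> R)
  (x : 'I_N -> 'I_d -> R) : (0 < Ncount Y s)%N ->
  (\sum_(i < N | Y i == s) psi k1 k2 (x i)) / (Ncount Y s)%:R =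
  k1 * (\sum_(p : 'I_N * 'I_d | Y p.1 == s) x p.1 p.2 ^+ 2) / (Ncount Y s)%:R + k2.
Proof.
move=> n0; rewrite big_split/= -mulr_sumr sumr_const mulrDl; congr (_ + _).
  rewrite pair_big/=; congr (_ * _ / _); apply: eq_bigl => p; by rewrite andbT.
rewrite -[k2 *+ _]mulr_natr -NcountE.
by rewrite mulfK// pnatr_eq0 -lt0n.
Qed.

Lemma card_class_coord (R : realType) (N d : nat) (s : R) (Y : 'I_N -> R) :
  #|[pred p : 'I_N * 'I_d | Y p.1 == s]| = (Ncount Y s * d)%N.
Proof.
rewrite NcountE -[in RHS](card_ord d) -cardX; apply: eq_card => -[i j].
by rewrite !inE /= andbT.
Qed.

(** * Test error for a given intercept *)

Lemma test_error_split (R : realType) (d : nat) (k1 k2 b : R)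
  (dQ : measure_display) (TQ : measurableType dQ) (Q : probability TQ R)
  (X : 'I_d -> {RV Q >-> R}) (Y : {RV Q >-> R}) :
  (forall t, Y t = 1 \/ Y t = -1) ->
  Q [set t | f_ss k1 k2 b (fun j => X j t) != Y t] =
  (Q (Y @^-1` [set 1%R] `&` [set t | (b <= psi k1 k2 (fun j => X j t))%R]) +
   Q (Y @^-1` [set (-1)%R] `&` [set t | (psi k1 k2 (fun j => X j t) <= b)%R]))%E.
Proof.
move=> hY; have mpsi := measurable_psi k1 k2 X.
rewrite -measureU.
- congr (Q _); apply/seteqP; split => t /=.
    by case: (hY t) => ->; [rewrite f_ss_neq1; left|rewrite f_ss_neqN1; right].
  by case=> -[->]; rewrite ?f_ss_neq1 ?f_ss_neqN1.
- apply: measurableI; first exact: measurable_funPTI.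
  exact: measurable_le_set.
- apply: measurableI; first exact: measurable_funPTI.
  exact: measurable_le_set.
- rewrite -subset0 => t [[/= -> _] [/= h _]].
  by move/eqP: h; rewrite -subr_eq0 opprK -(natrD _ 1 1) pnatr_eq0.
Qed.

(** Makes the success event of the training data measurable. As [b] grows, the error mass of class
    [+1] decreases and that of class [-1] increases, and monotone functions are measurable. *)
Lemma measurable_test_error (R : realType) (d : nat) (k1 k2 : R)
  (dQ : measure_display) (TQ : measurableType dQ) (Q : probability TQ R)
  (X : 'I_d -> {RV Q >-> R}) (Y : {RV Q >-> R}) :
  (forall t, Y t = 1 \/ Y t = -1) ->
  measurable_fun [set: R] (fun b => Q [set t | f_ss k1 k2 b (fun j => X j t) != Y t]).
Proof.
move=> hY; under eq_fun do rewrite test_error_split//.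
have mpsi := measurable_psi k1 k2 X.
have m1 b : measurable (Y @^-1` [set 1] `&` [set t | b <= psi k1 k2 (fun j => X j t)]).
  by apply: measurableI; [exact: measurable_funPTI|exact: measurable_le_set].
have m2 b : measurable (Y @^-1` [set -1] `&` [set t | psi k1 k2 (fun j => X j t) <= b]).
  by apply: measurableI; [exact: measurable_funPTI|exact: measurable_le_set].
have Qfin A : measurable A -> Q A = (fine (Q A))%:E.
  by move=> mA; rewrite fineK// fin_num_measure.
apply: emeasurable_funD.
- under eq_fun do rewrite Qfin//; apply/measurable_EFinP.
  apply: nonincreasing_measurable => // a b ab.
  rewrite fine_le ?fin_num_measure//; apply: le_measure; rewrite ?inE// => t [Yt/= h].
  by split => //=; exact: le_trans h.
- under eq_fun do rewrite Qfin//; apply/measurable_EFinP.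
  apply: nondecreasing_measurable => // a b ab.
  rewrite fine_le ?fin_num_measure//; apply: le_measure; rewrite ?inE// => t [Yt/= h].
  by split => //=; exact: le_trans ab.
Qed.

(** The window ends are relative deviations in disguise: [(1 + beta) (1 - delta) / 2 = 1 + e / 2]
    and [(1 + beta) (1 + delta) / 2 = beta (1 - e / (2 beta))]. *)
Lemma test_error_bound (R : realType) (d : nat)
  (sigma1 beta pplus k1 k2 delta b : R)
  (dQ : measure_display) (TQ : measurableType dQ) (Q : probability TQ R)
  (X : 'I_d -> {RV Q >-> R}) (Y : {RV Q >-> R}) :
  0 < sigma1 -> 3 < beta -> 0 < pplus < 1 -> 0 < k1 ->
  (forall t, Y t = 1 \/ Y t = -1) ->
  product_law Q (Y @^-1` [set 1]) pplus (fun j => X j)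
    (fun=> normal_prob 0 sigma1) ->
  product_law Q (Y @^-1` [set -1]) (1 - pplus) (fun j => X j)
    (fun=> normal_prob 0 (Num.sqrt beta * sigma1)) ->
  0 < delta < (beta - 1) / (beta + 1) ->
  k1 * (sigma1 ^+ 2 * d%:R * ((1 + beta) * (1 - delta) / 2)) + k2 <= b ->
  b <= k1 * (sigma1 ^+ 2 * d%:R * ((1 + beta) * (1 + delta) / 2)) + k2 ->
  (Q [set t | f_ss k1 k2 b (fun j => X j t) != Y t] <=
   (err_bound d beta pplus delta)%:E)%E.
Proof.
move=> s0 b3 /andP[p0 p1] k0 hY H1 H2 /andP[d0 d1] lb ub.
have mX j : measurable_fun setT (X j) by exact: measurable_funPT.
have mY a : measurable (Y @^-1` [set a]) by exact: measurable_funPTI.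
have mpsi := measurable_psi k1 k2 X.
have q0 : 0 <= 1 - pplus by lra.
have B0 : 0 < beta by lra.
have sb0 : 0 < Num.sqrt beta * sigma1 by rewrite mulr_gt0// sqrtr_gt0.
have cd : #|xpredT : pred 'I_d| = d by rewrite -[RHS]card_ord; exact: eq_card.
pose e := beta - 1 - (1 + beta) * delta.
have e0 : 0 < e.
  by move: d1; rewrite ltr_pdivlMr; rewrite /e; lra.
have e1 : 0 <= e / 2 by lra.
have e2 : 0 <= e / (2 * beta) <= 1.
  apply/andP; split; first by rewrite divr_ge0; lra.
  by rewrite ler_pdivrMr /e; nra.
(* The case distinction on [delta] is the change of regime of the upper tail at [t = e / 2]. *)
have ce : ((beta - 3) / (beta + 1) <= delta) = (e / 2 <= 1).
  rewrite ler_pdivrMr; last by lra.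
  by apply/idP/idP; rewrite /e; lra.
have T1 := sum_sqr_upper_tail mX (mY 1) (ltW p0) H1 (fun _ _ => erefl) cd s0 e1.
have T2 := sum_sqr_lower_tail mX (mY (-1)) q0 H2 (fun _ _ => erefl) cd sb0 e2.
(* The constants 32, 16 and [32 * beta ^+ 2] come from inserting [e / 2] and [e / (2 * beta)] into
   tail exponents with divisor 8. *)
have -> : err_bound d beta pplus delta =
  pplus * expR (- (d%:R * (if e / 2 <= 1 then (e / 2) ^+ 2 else e / 2) / 8)) +
  (1 - pplus) * expR (- (d%:R * (e / (2 * beta)) ^+ 2 / 8)).
  rewrite /err_bound -/e ce.
  have -> : d%:R * (e / (2 * beta)) ^+ 2 / 8 = d%:R * e ^+ 2 / (32 * beta ^+ 2).
    by field; rewrite gt_eqF.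
  case: ifP => _; congr (_ * expR (- _) + _); by field.
rewrite test_error_split// EFinD; apply: leeD.
- apply: le_trans T1; apply: le_measure; rewrite ?inE.
  + by apply: measurableI => //; exact: measurable_le_set.
  + apply: measurableI => //; apply: measurable_le_set => //.
    exact: measurable_sum_sqr.
  + move=> t [Yt /= h]; split => //=.
    have := le_trans lb h; rewrite /psi lerD2r ler_pM2l//.
    suff -> : (1 + beta) * (1 - delta) / 2 = 1 + e / 2 by [].
    by rewrite /e; field.
- apply: le_trans T2; apply: le_measure; rewrite ?inE.
  + by apply: measurableI => //; exact: measurable_le_set.
  + apply: measurableI => //; apply: measurable_le_set => //.
    exact: measurable_sum_sqr.
  + move=> t [Yt /= h]; split => //=.
    have := le_trans h ub; rewrite /psi lerD2r ler_pM2l//.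
    rewrite exprMn sqr_sqrtr ?(ltW B0)//.
    suff -> : sigma1 ^+ 2 * d%:R * ((1 + beta) * (1 + delta) / 2) =
       beta * sigma1 ^+ 2 * d%:R * (1 - e / (2 * beta)) by [].
    by rewrite /e; field; rewrite gt_eqF.
Qed.

(** * Concentration of the intercept over the training data *)

Theorem theorem3 (R : realType) (d N : nat) (sigma1 beta pplus k1 k2 delta : R)
  (* test distribution P_XY on a probability space (TQ, Q) *)
  (dQ : measure_display) (TQ : measurableType dQ) (Q : probability TQ R)
  (Xt : 'I_d -> {RV Q >-> R}) (Yt : {RV Q >-> R})
  (* training data on a probability space (TP, P), labels fixed *)
  (dP : measure_display) (TP : measurableType dP) (P : probability TP R)
  (Ytr : 'I_N -> R) (Xtr : 'I_N -> 'I_d -> {RV P >-> R}) :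
  (1 <= d)%N -> 0 < sigma1 -> 3 < beta ->
  0 < pplus < 1 -> 2^-1 <= 1 - pplus ->
  0 < k1 -> 0 < k2 ->
  (* P(Y = +1) = p+, X | Y = +1 ~ N(0, sigma1^2 I_d); P(Y = -1) = p-, X | Y = -1 ~ N(0, beta sigma1^2 I_d) *)
  (forall t, Yt t = 1 \/ Yt t = -1) ->
  (forall B : 'I_d -> set R, (forall j, measurable (B j)) ->
     Q (Yt @^-1` [set 1] `&` \bigcap_(j in [set: 'I_d]) (Xt j @^-1` B j)) =
     (pplus%:E * \prod_(j : 'I_d) normal_prob 0 sigma1 (B j))%E) ->
  (forall B : 'I_d -> set R, (forall j, measurable (B j)) ->
     Q (Yt @^-1` [set -1] `&` \bigcap_(j in [set: 'I_d]) (Xt j @^-1` B j)) =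
     ((1 - pplus)%:E * \prod_(j : 'I_d) normal_prob 0 (Num.sqrt beta * sigma1) (B j))%E) ->
  (* training labels and data *)
  (forall i, Ytr i = 1 \/ Ytr i = -1) ->
  (1 <= Ncount Ytr 1)%N -> (1 <= Ncount Ytr (-1))%N ->
  indep_family (fun ij : 'I_N * 'I_d => Xtr ij.1 ij.2) ->
  (forall i j A, measurable A -> Ytr i = 1 ->
     P (Xtr i j @^-1` A) = normal_prob 0 sigma1 A) ->
  (forall i j A, measurable A -> Ytr i = -1 ->
     P (Xtr i j @^-1` A) = normal_prob 0 (Num.sqrt beta * sigma1) A) ->
  0 < delta < (beta - 1) / (beta + 1) ->
  let b := fun w : TP => intercept k1 k2 Ytr (fun i j => Xtr i j w) in
  let err := fun bb : R =>
    Q [set t | f_ss k1 k2 bb (fun j => Xt j t) != Yt t] in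
  (P [set w | (err (b w) <= (err_bound d beta pplus delta)%:E)%E] >=
   (1 - 2 * expR (- ((Ncount Ytr (-1))%:R * d%:R * delta ^+ 2 / 8))
       - 2 * expR (- ((Ncount Ytr 1)%:R * d%:R * delta ^+ 2 / 8)))%:E)%E.
Proof.
move=> d1 s0 b3 hp hp2 k10 k20 hY H1 H2 hYtr N1 N2 hind HX1 HX2 hdelta; cbv zeta.
pose b w := intercept k1 k2 Ytr (fun i j => Xtr i j w).
have [d0 dlt] := andP hdelta.
have dl1 : delta < 1.
  by apply: (lt_le_trans dlt); rewrite ler_pdivrMr; lra.
have B0 : 0 < beta by lra.
pose s2 := Num.sqrt beta * sigma1.
have s20 : 0 < s2 by rewrite mulr_gt0// sqrtr_gt0.
have s2E : s2 ^+ 2 = beta * sigma1 ^+ 2 by rewrite exprMn sqr_sqrtr ?(ltW B0).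
have N11 : (-1 == 1 :> R) = false by apply/eqP; lra.
(* All [N * d] coordinates form one independent family, so each class is merely a choice of the
   index predicate [S]. *)
pose mu (p : 'I_N * 'I_d) : probability (measurableTypeR R) R :=
  normal_prob 0 (if Ytr p.1 == 1 then sigma1 else s2).
have mX (p : 'I_N * 'I_d) : measurable_fun setT (Xtr p.1 p.2) by exact: measurable_funPT.
have HP : product_law P setT 1 (fun p : 'I_N * 'I_d => Xtr p.1 p.2 : TP -> R) mu.
  move=> B mB; rewrite setTI mul1e; apply: etrans (hind B mB) _; apply: eq_bigr => p _.
  rewrite /mu; case: (hYtr p.1) => Yp.
    by rewrite Yp eqxx; apply: HX1.
  by rewrite Yp N11; apply: HX2.
have dl01 : 0 <= delta <= 1 by lra.
have S1 (p : 'I_N * 'I_d) : Ytr p.1 == 1 -> mu p = normal_prob 0 sigma1.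
  by rewrite /mu => ->.
have S2 (p : 'I_N * 'I_d) : Ytr p.1 == -1 -> mu p = normal_prob 0 s2.
  by rewrite /mu => /eqP ->; rewrite N11.
have U1 := sum_sqr_upper_tail mX measurableT ler01 HP S1 (card_class_coord _ _ _) s0 (ltW d0).
have L1 := sum_sqr_lower_tail mX measurableT ler01 HP S1 (card_class_coord _ _ _) s0 dl01.
have U2 := sum_sqr_upper_tail mX measurableT ler01 HP S2 (card_class_coord _ _ _) s20 (ltW d0).
have L2 := sum_sqr_lower_tail mX measurableT ler01 HP S2 (card_class_coord _ _ _) s20 dl01.
(* Since [delta < 1], the upper tails are in the quadratic regime and share the exponent of the
   lower ones. *)
move: U1 L1 U2 L2; rewrite (ltW dl1) !setTI !mul1r !natrM.
set n1 := (Ncount Ytr 1)%:R; set n2 := (Ncount Ytr (-1))%:R.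
set a1 := expR (- (n1 * _ * _ / 8)); set a2 := expR (- (n2 * _ * _ / 8)).
set E1 := [set w | _]; set E2 := [set w | _];
set E3 := [set w | _]; set E4 := [set w | _].
move=> P1 P2 P3 P4.
set G := [set w | _].
have mE1 : measurable E1.
  by apply: measurable_le_set => //; exact: measurable_sum_sqr.
have mE2 : measurable E2.
  by apply: measurable_le_set => //; exact: measurable_sum_sqr.
have mE3 : measurable E3.
  by apply: measurable_le_set => //; exact: measurable_sum_sqr.
have mE4 : measurable E4.
  by apply: measurable_le_set => //; exact: measurable_sum_sqr.
have mG : measurable G.
  have merr := measurable_test_error k1 k2 Xt hY.
  have mb := measurable_intercept k1 k2 Ytr Xtr.
  have := emeasurable_fun_infty_c measurableT (measurableT_comp merr mb)
     (err_bound d beta pplus delta)%:E.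
  by rewrite setTI.
(* Off the four tail events the intercept lies in the window where the test
   error is controlled. *)
have cover : [set: TP] `<=` G `|` ((E1 `|` E2) `|` (E3 `|` E4)).
  move=> w _; have [|hE1] := pselect (E1 w); first by right; left; left.
  have [|hE2] := pselect (E2 w); first by right; left; right.
  have [|hE3] := pselect (E3 w); first by right; right; left.
  have [|hE4] := pselect (E4 w); first by right; right; right.
  left; rewrite /G/= -/(b w).
  move: hE1 hE2 hE3 hE4 => /negP; rewrite -ltNge => hE1 /negP; rewrite -ltNge => hE2.
  move=> /negP; rewrite -ltNge => hE3 /negP; rewrite -ltNge => hE4.
  have n10 : 0 < n1 by rewrite ltr0n.
  have n20 : 0 < n2 by rewrite ltr0n.
  (* The intercept is the map [k1 * _ + k2] of [psi] applied to the midpoint of the two class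
     averages, so the window reduces to bounds on these averages. *)
  have bE : b w = k1 * ((\sum_(p : 'I_N * 'I_d | Ytr p.1 == 1) Xtr p.1 p.2 w ^+ 2 / n1 +
      \sum_(p : 'I_N * 'I_d | Ytr p.1 == -1) Xtr p.1 p.2 w ^+ 2 / n2) / 2) + k2.
    rewrite /b /intercept !class_mean_psi// -/n1 -/n2 -!mulr_suml.
    by field; rewrite !gt_eqF.
  have avg_ge (n u v W : R) : 0 < n -> u * (n * d%:R) * v < W -> u * d%:R * v <= W / n.
    move=> n0 h; rewrite ler_pdivlMr// ltW//.
    by rewrite (_ : u * d%:R * v * n = u * (n * d%:R) * v)//; ring.
  have avg_le (n u v W : R) : 0 < n -> W < u * (n * d%:R) * v -> W / n <= u * d%:R * v.
    move=> n0 h; rewrite ler_pdivrMr// ltW//.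
    by rewrite (_ : u * d%:R * v * n = u * (n * d%:R) * v)//; ring.
  apply: (test_error_bound (sigma1 := sigma1)) => //.
  - rewrite bE lerD2r ler_pM2l// ler_pdivlMr//.
    have -> : sigma1 ^+ 2 * d%:R * ((1 + beta) * (1 - delta) / 2) * 2 =
      sigma1 ^+ 2 * d%:R * (1 - delta) + s2 ^+ 2 * d%:R * (1 - delta).
      by rewrite s2E; field.
    by apply: lerD; rewrite -mulr_suml; apply: avg_ge.
  - rewrite bE lerD2r ler_pM2l// ler_pdivrMr//.
    have -> : sigma1 ^+ 2 * d%:R * ((1 + beta) * (1 + delta) / 2) * 2 =
      sigma1 ^+ 2 * d%:R * (1 + delta) + s2 ^+ 2 * d%:R * (1 + delta).
      by rewrite s2E; field.
    by apply: lerD; rewrite -mulr_suml; apply: avg_le.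
(* Union bound over an upper and a lower tail for each class, whence the two factors 2. *)
have PU : (P ((E1 `|` E2) `|` (E3 `|` E4)) <= (2 * a2 + 2 * a1)%:E)%E.
  have -> : (2 * a2 + 2 * a1)%:E = ((a1%:E + a1%:E) + (a2%:E + a2%:E))%E.
    by rewrite -!EFinD; congr EFin; ring.
  by do ![apply: le_trans (measureU2 _ _ _) _ => //; try exact: measurableU; apply: leeD].
have : (1 <= P G + (2 * a2 + 2 * a1)%:E)%E.
  have mU : measurable ((E1 `|` E2) `|` (E3 `|` E4)) by do !apply: measurableU.
  rewrite -(@probability_setT _ _ _ P).
  apply: le_trans (leeD (lexx _) PU); apply: le_trans (measureU2 _ mG mU).
  by apply: le_measure; rewrite ?inE//; exact: measurableU.
rewrite -leeBlDr// -EFinB => /(le_trans _); apply.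
by rewrite lee_fin; lra.
Qed.
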